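(* Let $I\subset\mathbb{R}$ be an open interval, let $\gamma:I\to\mathbb{R}$ be a smooth function, and let $\delta$ be a nonzero real constant. Let $x(t),y(t),z(t)$ be three linearly independent (smooth, real-valued) solutions on $I$ of the homogeneous third-order linear ODE $$u'''+\gamma(t)u'+\delta u=0,$$ such that $W(x,y,z)(t)\neq 0$ and $W(x',y',z')(t)\neq 0$ for all $t\in I$. Then $x,y,z$ satisfy the Tzitzeica curve equation $$W(x',y',z')(t)=\alpha\left[W(x,y,z)(t)\right]^2\quad\text{for all } t\in I,$$ where the curve's constant $\alpha$ (a nonzero real number independent of $t$) is given by $$\alpha=-\frac{\delta}{W(x,y,z)(t)}.$$
   Context: For smooth functions $x,y,z$ on an open interval $I$, the Wronskian is $$W(x,y,z)(t)=\begin{vmatrix} x(t)&y(t)&z(t)\\ x'(t)&y'(t)&z'(t)\\ x''(t)&y''(t)&z''(t)\end{vmatrix},$$ and the Wronskian of the first derivatives is $$W(x',y',z')(t)=\begin{vmatrix} x'(t)&y'(t)&z'(t)\\ x''(t)&y''(t)&z''(t)\\ x'''(t)&y'''(t)&z'''(t)\end{vmatrix}.$$ The Tzitzeica curve equation, with curve's constant $\alpha$, a nonzero real number, is the equation $W(x',y',z')(t)=\alpha\left[W(x,y,z)(t)\right]^2$ for all $t\in I$. *)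

(* Defs.v *)
From HB Require Import structures.
From mathcomp Require Import all_boot all_order all_algebra.
From mathcomp Require Import all_classical all_reals all_analysis.
Set Implicit Arguments.
Unset Strict Implicit.
Unset Printing Implicit Defensive.
Import Order.TTheory GRing.Theory Num.Theory.
Import numFieldNormedType.Exports.
Local Open Scope ring_scope.
Local Open Scope classical_set_scope.

(* Functions on an open interval I are represented by total functions R -> R,
   constrained only at the points of I; since I is open, their derivatives at
   points of I depend only on their values on I.  The notation ^`() is avoided:
   in ring_scope it denotes the formal derivative of a polynomial. *)

Definition open_interval (R : realType) (I : set R) : Prop :=
  [/\ I !=set0, open I & is_interval I].

Definition smooth_on (R : realType) (I : set R) (f : R -> R) : Prop :=
  forall (n : nat) (t : R), I t -> derivable (derive1n n f) t 1.

Definition wronskian (R : realType) (x y z : R -> R) (t : R) : R :=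
  \det (\matrix_(i < 3, j < 3) derive1n i (tnth [tuple x; y; z] j) t).

Definition lin_indep_on (R : realType) (I : set R) (x y z : R -> R) : Prop :=
  forall a b c : R,
    (forall t, I t -> a * x t + b * y t + c * z t = 0) ->
    [/\ a = 0, b = 0 & c = 0].

Definition ode_solution (R : realType) (I : set R) (gamma : R -> R) (delta : R)
    (u : R -> R) : Prop :=
  smooth_on I u /\
  forall t, I t -> derive1n 3 u t + gamma t * derive1 u t + delta * u t = 0.

Definition tzitzeica_curve (R : realType) (I : set R) (alpha : R)
    (x y z : R -> R) : Prop :=
  alpha != 0 /\
  forall t, I t ->
    wronskian (derive1 x) (derive1 y) (derive1 z) t = alpha * wronskian x y z t ^+ 2.

(* Main.v *)
(* Differentiating the last row of W(x,y,z) replaces it by u''' = - gamma u' - delta u,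
   a combination of the other two rows, so W is constant on I (Abel: the equation has no
   u'' term).  The same substitution in the last row of W(x',y',z') leaves only the
   delta u part, and a cyclic permutation of the rows gives W(x',y',z') = - delta W. *)

Require Import Defs.
From HB Require Import structures.
From mathcomp Require Import all_boot all_order all_algebra ring.
From mathcomp Require Import all_classical all_reals all_analysis.
Import Order.TTheory GRing.Theory Num.Theory.
Import numFieldNormedType.Exports.
Local Open Scope ring_scope.
Local Open Scope classical_set_scope.

(** Mean value theorem on the segment between the two points, which lies in [I] because [I] is an
    interval. *)
Lemma is_interval_derive0_cst {R : realType} {I : set R} {f : R -> R} :
  is_interval I -> (forall t, I t -> is_derive t 1 f 0) ->
  forall s t, I s -> I t -> f s = f t.
Proof.
move=> itvI df0 s t.
wlog st : s t / s <= t => [wlg Is It|Is It].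
  by have [/wlg|/ltW/wlg] := leP s t; [apply|move=> ->].
have subI u : u \in `[s, t]%R -> I u by rewrite in_itv/=; exact: itvI.
have [||c _] := @MVT_segment _ f (fun=> 0) _ _ st.
- by move=> u /subset_itv_oo_cc/subI; exact: df0.
- by apply: derivable_within_continuous => u /subI/df0[].
- by rewrite mul0r => /subr0_eq.
Qed.

(** Laplace expansion along the first row; in this polynomial form the Wronskian can be
    differentiated and handled by [ring]. *)
Lemma wronskianE {R : realType} (x y z : R -> R) (t : R) :
  wronskian x y z t =
    x t * (derive1n 1 y t * derive1n 2 z t - derive1n 1 z t * derive1n 2 y t)
  - y t * (derive1n 1 x t * derive1n 2 z t - derive1n 1 z t * derive1n 2 x t)
  + z t * (derive1n 1 x t * derive1n 2 y t - derive1n 1 y t * derive1n 2 x t).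
Proof.
rewrite /wronskian (expand_det_row _ 0) !big_ord_recl big_ord0 /cofactor.
rewrite !(expand_det_row _ 0) !big_ord_recl !big_ord0 /cofactor.
rewrite !det_mx11 !mxE !(tnth_nth x) /=.
(* [ring] compares its atoms up to conversion, which unfolds [derive1]: generalize first. *)
move: (derive1 (derive1 x) t) (derive1 (derive1 y) t) (derive1 (derive1 z) t).
move: (derive1 x t) (derive1 y t) (derive1 z t) (x t) (y t) (z t) => *.
by ring.
Qed.

Lemma smooth_on_is_derive {R : realType} {I : set R} {f : R -> R} (n : nat) {t : R} :
  smooth_on I f -> I t -> is_derive t 1 (derive1n n f) (derive1n n.+1 f t).
Proof.
move=> smf It; rewrite derive1nS derive1E.
exact/derivableP/smf.
Qed.

(** Each of the first two rows has the next row as its derivative, so differentiating it gives a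
    determinant with two equal rows; only the term from the last row survives. *)
Lemma is_derive_det3 {R : realType} {f g h f1 g1 h1 f2 g2 h2 : R -> R} {t df2 dg2 dh2 : R} :
  is_derive t 1 f (f1 t) -> is_derive t 1 g (g1 t) -> is_derive t 1 h (h1 t) ->
  is_derive t 1 f1 (f2 t) -> is_derive t 1 g1 (g2 t) -> is_derive t 1 h1 (h2 t) ->
  is_derive t 1 f2 df2 -> is_derive t 1 g2 dg2 -> is_derive t 1 h2 dh2 ->
  is_derive t 1
    (f * (g1 * h2 - h1 * g2) - g * (f1 * h2 - h1 * f2) + h * (f1 * g2 - g1 * f2))
    (f t * (g1 t * dh2 - h1 t * dg2) - g t * (f1 t * dh2 - h1 t * df2)
     + h t * (f1 t * dg2 - g1 t * df2)).
Proof.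
move=> df dg dh df1 dg1 dh1 df2' dg2' dh2'.
apply: is_derive_eq (is_deriveD (is_deriveB
  (is_deriveM df (is_deriveB (is_deriveM dg1 dh2') (is_deriveM dh1 dg2')))
  (is_deriveM dg (is_deriveB (is_deriveM df1 dh2') (is_deriveM dh1 df2'))))
  (is_deriveM dh (is_deriveB (is_deriveM df1 dg2') (is_deriveM dg1 df2')))) _.
by rewrite !fctE /GRing.scale /=; ring.
Qed.

Lemma is_derive_wronskian {R : realType} {I : set R} {x y z : R -> R} {t : R} :
  smooth_on I x -> smooth_on I y -> smooth_on I z -> I t ->
  is_derive t 1 (wronskian x y z)
    (x t * (derive1n 1 y t * derive1n 3 z t - derive1n 1 z t * derive1n 3 y t)
   - y t * (derive1n 1 x t * derive1n 3 z t - derive1n 1 z t * derive1n 3 x t)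
   + z t * (derive1n 1 x t * derive1n 3 y t - derive1n 1 y t * derive1n 3 x t)).
Proof.
move=> smx smy smz It.
have d n u : smooth_on I u -> is_derive t 1 (derive1n n u) (derive1n n.+1 u t).
  by move=> smu; exact: smooth_on_is_derive smu It.
rewrite (funext (wronskianE x y z)).
exact: (is_derive_det3 (d 0%N _ smx) (d 0%N _ smy) (d 0%N _ smz)
  (d 1%N _ smx) (d 1%N _ smy) (d 1%N _ smz) (d 2%N _ smx) (d 2%N _ smy) (d 2%N _ smz)).
Qed.

Lemma ode_solution_derive1n3 {R : realType} {I : set R} {gamma : R -> R} {delta : R}
    {u : R -> R} {t : R} :
  ode_solution I gamma delta u -> I t ->
  derive1n 3 u t = - gamma t * derive1n 1 u t - delta * u t.
Proof.
by move=> [_ /[apply]/eqP]; rewrite -addrA addr_eq0 => /eqP ->; rewrite opprD mulNr.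
Qed.

Lemma wronskian_cst {R : realType} {I : set R} {gamma : R -> R} {delta : R}
    {x y z : R -> R} {s t : R} :
  ode_solution I gamma delta x -> ode_solution I gamma delta y ->
  ode_solution I gamma delta z -> is_interval I -> I s -> I t ->
  wronskian x y z s = wronskian x y z t.
Proof.
move=> solx soly solz itvI; apply: is_interval_derive0_cst => // {}s {t}.
move=> Is; apply: is_derive_eq.
  exact: is_derive_wronskian solx.1 soly.1 solz.1 Is.
rewrite !(ode_solution_derive1n3 solx Is, ode_solution_derive1n3 soly Is,
          ode_solution_derive1n3 solz Is).
(* The last row is now [- gamma] times the second row minus [delta] times the first, so the
   determinant vanishes. *)
move: (derive1n 1 x s) (derive1n 1 y s) (derive1n 1 z s) (x s) (y s) (z s) => *.
by ring.
Qed.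

Lemma wronskian_derive1 {R : realType} {I : set R} {gamma : R -> R} {delta : R}
    {x y z : R -> R} {t : R} :
  ode_solution I gamma delta x -> ode_solution I gamma delta y ->
  ode_solution I gamma delta z -> I t ->
  wronskian (derive1 x) (derive1 y) (derive1 z) t = - delta * wronskian x y z t.
Proof.
(* Derivatives of [derive1 x] are reindexed as higher derivatives of [x], so that the third ones can
   be replaced through the equation. *)
move=> solx soly solz It; rewrite !wronskianE -!derive1Sn.
rewrite !(ode_solution_derive1n3 solx It, ode_solution_derive1n3 soly It,
          ode_solution_derive1n3 solz It) !derive1n1.
(* The [gamma] part repeats the first row; a cyclic permutation of three rows is even, so the only
   sign is that of [- delta]. *)
move: (derive1n 2 x t) (derive1n 2 y t) (derive1n 2 z t).
move: (derive1 x t) (derive1 y t) (derive1 z t) (x t) (y t) (z t) => *.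
by ring.
Qed.

Theorem proposition3p1 (R : realType) (I : set R) (gamma : R -> R) (delta : R)
    (x y z : R -> R)
    (hI : open_interval I)
    (hgamma : smooth_on I gamma)
    (hdelta : delta != 0)
    (hx : ode_solution I gamma delta x)
    (hy : ode_solution I gamma delta y)
    (hz : ode_solution I gamma delta z)
    (hindep : lin_indep_on I x y z)
    (hW : forall t, I t -> wronskian x y z t != 0)
    (hW' : forall t, I t -> wronskian (derive1 x) (derive1 y) (derive1 z) t != 0) :
  exists alpha : R,
    tzitzeica_curve I alpha x y z /\
    forall t, I t -> alpha = - (delta / wronskian x y z t).
Proof.
have [[t0 It0] _ itvI] := hI.
have Wcst t (It : I t) := wronskian_cst hx hy hz itvI It It0.
(* Evaluating at the fixed point [t0] makes the constant independent of [t]; [Wcst] carries the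
   formula to every other point. *)
exists (- (delta / wronskian x y z t0)); split=> [|t It]; last by rewrite Wcst.
split=> [|t It]; first by rewrite oppr_eq0 mulf_neq0 ?invr_neq0 ?hW.
(* One factor of the squared Wronskian cancels the denominator of the constant, leaving [- delta]
   times the Wronskian. *)
by rewrite (wronskian_derive1 hx hy hz It) Wcst// expr2 mulrA !mulNr divfK ?hW.
Qed.
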